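(* Let $\mathcal{A}, \mathcal{B} \subseteq \mathbb{N}$. If $\mathbf{d}(\mathcal{A}) = \mathbf{d}(\mathcal{B}) = 1$, then $\mathbf{d}(\mathcal{A}\cdot\mathcal{B}) = 1$.
   Context: $\mathbb{N}=\{1,2,3,\dots\}$. For sets $\mathcal{A},\mathcal{B}\subseteq\mathbb{N}$, the product set is $\mathcal{A}\cdot\mathcal{B}:=\{ab : a\in\mathcal{A},\ b\in\mathcal{B}\}$. The natural density of $\mathcal{A}\subseteq\mathbb{N}$ is $\mathbf{d}(\mathcal{A})=\lim_{x\to\infty}\#(\mathcal{A}\cap[1,x])/x$, when this limit exists; the statement $\mathbf{d}(\mathcal{A})=1$ means that this limit exists and equals $1$. *)

(* Defs.v *)
From HB Require Import structures.
From mathcomp Require Import all_boot all_order all_algebra finmap.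
From mathcomp Require Import all_classical all_reals all_analysis.

Set Implicit Arguments.
Unset Strict Implicit.
Unset Printing Implicit Defensive.

Import Order.TTheory GRing.Theory Num.Theory.
Import numFieldNormedType.Exports.

Local Open Scope classical_set_scope.
Local Open Scope ring_scope.

(* The positive integers, as a subset of [nat] (which contains 0). *)
Definition Npos : set nat := [set n | (0 < n)%N].

Definition product_set (A B : set nat) : set nat :=
  [set (a * b)%N | a in A & b in B].

Definition upto (R : realType) (A : set nat) (x : R) : set nat :=
  A `&` [set n | (1 : R) <= n%:R <= x].

(* [fset_set] sends every infinite set to the empty one; this never happens in
   [counting_function]. *)
Lemma finite_upto (R : realType) (A : set nat) (x : R) :
  finite_set (upto A x).
Proof.
apply: (@sub_finite_set _ _ `I_(Num.truncn x).+1); last exact: finite_II.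
move=> n [_ /= /andP[_ nx]].
by rewrite ltnS truncn_ge_nat // (le_trans _ nx).
Qed.

Definition counting_function (R : realType) (A : set nat) (x : R) : nat :=
  #|` fset_set (upto A x)|%fset.

(* "The natural density of A exists and equals l"; [x] is a real variable. *)
Definition has_density (R : realType) (A : set nat) (l : R) : Prop :=
  (counting_function A x)%:R / x @[x --> +oo] --> l.

(* Main.v *)
(** Fix [x], and let [N] be the square of [x!].  For [n] uniform modulo [N] the
    exponents in [gcd n N] are independent, so indicators of divisor-closed
    sets of values of [gcd n N] are positively correlated (an FKG inequality).
    Apply this to the set of integers without divisor in [B] up to [x] and to
    the integers at most [x]: given [gcd n N <= x], the value [d] has
    probability proportional to [1 / d], so the density of the integers with no
    divisor in [B] up to [x] is at most the logarithmic average over [1..x] of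
    the complement of [B], which is small for a suitable [x].  All other
    integers are [b * m] with [b] in [B], [b <= x], and for fixed [x] almost
    all of them have [m] in [A]. *)

Require Import Defs.
From HB Require Import structures.
From mathcomp Require Import all_boot all_order all_algebra finmap.
From mathcomp Require Import all_classical all_reals all_analysis.
From mathcomp Require Import ring lra zify.

Set Implicit Arguments.
Unset Strict Implicit.
Unset Printing Implicit Defensive.

Import Order.TTheory GRing.Theory Num.Theory.
Import numFieldNormedType.Exports.

Local Open Scope classical_set_scope.
Local Open Scope ring_scope.

(** * Sums over periods and over multiples *)

Lemma sum_nat_periodic (V : nmodType) (h : nat -> V) (q k : nat) :
  (forall n, h (n + q)%N = h n) ->
  \sum_(0 <= n < k * q) h n = (\sum_(0 <= n < q) h n) *+ k.
Proof.
move=> hq; have hqk j n : h (n + j * q)%N = h n.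
  by elim: j => [|j IH]; rewrite ?addn0 // mulSn addnCA addnC hq.
elim: k => [|k IH]; first by rewrite big_geq.
rewrite mulSn addnC (big_cat_nat (n := k * q)) ?leq_addr //= IH mulrSr; congr (_ + _).
rewrite -{1}(add0n (k * q)%N) big_addn addKn.
by apply: eq_bigr => n _; rewrite hqk.
Qed.

Lemma sum_nat_dvd (V : nmodType) (h : nat -> V) (p m : nat) : (0 < p)%N ->
  \sum_(0 <= n < p * m | (p %| n)%N) h n = \sum_(0 <= n < m) h (p * n)%N.
Proof.
move=> p0; elim: m => [|m IH]; first by rewrite muln0 !big_geq.
rewrite mulnS addnC (big_cat_nat (n := p * m)) ?leq_addr //= IH.
rewrite [RHS]big_nat_recr //=; congr (_ + _).
rewrite big_ltn_cond; last by rewrite -[ltnLHS]addn0 ltn_add2l.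
rewrite dvdn_mulr // big_nat_cond big1 ?addr0 // => i /andP[/andP[lo hi]].
rewrite -(subnKC (ltnW lo)) dvdn_addr ?dvdn_mulr // => /dvdn_leq.
by rewrite subn_gt0 lo => /(_ isT); lia.
Qed.

(** * Means of functions of a gcd and their correlation inequality *)

Definition dvd_decreasing (R : numDomainType) (f : nat -> R) : Prop :=
  forall d n, (0 < n)%N -> (d %| n)%N -> f n <= f d.

Definition gcd_mean (R : fieldType) (f : nat -> R) (N : nat) : R :=
  (\sum_(0 <= n < N) f (gcdn n N)) / N%:R.

Lemma sum_gcd_dvd (R : numFieldType) (f : nat -> R) (M N : nat) :
  (0 < N)%N -> (M %| N)%N ->
  \sum_(0 <= n < N) f (gcdn n M) = gcd_mean f M * N%:R.
Proof.
move=> N0 /dvdnP[k Nk]; move: N0; rewrite Nk muln_gt0 => /andP[k0 M0].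
rewrite sum_nat_periodic => [|n]; last by rewrite gcdnC gcdnDr gcdnC.
by rewrite /gcd_mean natrM -mulr_natr; field; rewrite pnatr_eq0 -lt0n.
Qed.

(** Over the common period [N] the two sums compare term by term, because [gcdn n M] divides
    [gcdn n N]. *)
Lemma le_gcd_mean (R : numFieldType) (f : nat -> R) (M N : nat) :
  dvd_decreasing f -> (0 < N)%N -> (M %| N)%N -> gcd_mean f N <= gcd_mean f M.
Proof.
move=> fdec N0 MN; rewrite {1}/gcd_mean ler_pdivrMr ?ltr0n // -sum_gcd_dvd //.
apply: ler_sum => n _; apply: fdec; first by rewrite gcdn_gt0 N0 orbT.
by rewrite dvdn_gcd dvdn_gcdl (dvdn_trans (dvdn_gcdr _ _)).
Qed.

(* Conditions on whether [p] divides [n]: if not, the gcd with [p ^ e * m] is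
   the gcd with [m]; if [n = p * n'], it is [p] times a gcd with [p ^ e.-1 * m]. *)
Lemma gcd_mean_prime (R : numFieldType) (f : nat -> R) (p e m : nat) :
  prime p -> coprime p m -> (0 < m)%N ->
  gcd_mean f (p ^ e.+1 * m) =
  (1 - p%:R^-1) * gcd_mean f m
  + p%:R^-1 * gcd_mean (fun d => f (p * d)%N) (p ^ e * m).
Proof.
move=> pp pm m0; have p0 := prime_gt0 pp.
set M := (p ^ e * m)%N; have M0 : (0 < M)%N by rewrite muln_gt0 expn_gt0 p0.
have -> : (p ^ e.+1 * m)%N = (p * M)%N by rewrite expnS mulnA.
have pM0 : (0 < p * M)%N by rewrite muln_gt0 p0.
have mM : (m %| M)%N by rewrite dvdn_mull.
have split n : f (gcdn n (p * M)) = f (gcdn n m) +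
    (if (p %| n)%N then f (gcdn n (p * M)) - f (gcdn n m) else 0).
  case: ifPn => [_|pn]; first by rewrite addrC subrK.
  rewrite addr0 /M mulnA -expnS Gauss_gcdr // coprimeXr //.
  by rewrite coprime_sym prime_coprime.
rewrite [LHS]/gcd_mean (eq_bigr _ (fun n _ => split n)) big_split /=.
rewrite sum_gcd_dvd ?dvdn_mull // -big_mkcond sum_nat_dvd //= sumrB.
have -> : \sum_(0 <= n < M) f (gcdn (p * n) (p * M)) =
    gcd_mean (fun d => f (p * d)%N) M * M%:R.
  rewrite -sum_gcd_dvd //; apply: eq_bigr => n _.
  by rewrite muln_gcdr.
have -> : \sum_(0 <= n < M) f (gcdn (p * n) m) = gcd_mean f m * M%:R.
  rewrite -sum_gcd_dvd //; apply: eq_bigr => n _.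
  by rewrite gcdnC Gauss_gcdr 1?coprime_sym // gcdnC.
by rewrite natrM; field; rewrite !pnatr_eq0 -!lt0n p0.
Qed.

(** Induction on [N], removing one factor of a prime [p]. By [gcd_mean_prime] each mean is a convex
    combination of the means conditioned on whether [p] divides [n]. The induction hypothesis
    handles both conditional means of the product, and conditioning on divisibility lowers the means
    of [f] and [g] alike. *)
Lemma gcd_mean_correlation (R : realFieldType) (f g : nat -> R) (N : nat) :
  (0 < N)%N -> dvd_decreasing f -> dvd_decreasing g ->
  gcd_mean f N * gcd_mean g N <= gcd_mean (fun d => f d * g d) N.
Proof.
elim/ltn_ind: N f g => N IH f g N0 fdec gdec.
have [N1|N1] := leqP N 1.
  have -> : N = 1%N by lia.
  by rewrite /gcd_mean !big_nat1 !divr1.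
have := pdiv_dvd N; have := pdiv_prime N1; move: (pdiv N) => p pp pN.
have [m pm Nm] := pfactor_coprime pp N0.
have m0 : (0 < m)%N by move: N0; rewrite Nm muln_gt0 => /andP[].
have : (0 < logn p N)%N by rewrite logn_gt0 mem_primes pp N0 pN.
case: (logn p N) Nm => // e; rewrite mulnC => Nm _.
have p1 := prime_gt1 pp; have p0 := ltnW p1.
have M0 : (0 < p ^ e * m)%N by rewrite muln_gt0 expn_gt0 p0.
have MN : (p ^ e * m < N)%N by rewrite Nm ltn_mul2r m0 ltn_exp2l ?ltnSn.
have mN : (m < N)%N.
  by apply: leq_ltn_trans MN; rewrite leq_pmull // expn_gt0 p0.
have shift (h : nat -> R) : dvd_decreasing h ->
    dvd_decreasing (fun d => h (p * d)%N).
  by move=> hdec d n n0 dn; apply: hdec; rewrite ?muln_gt0 ?p0 ?dvdn_pmul2l.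
(* Two decreases combine: from [p ^ e * m] down to its divisor [m], then from [p * d] down to
   [d]. *)
have shift_le (h : nat -> R) : dvd_decreasing h ->
    gcd_mean (fun d => h (p * d)%N) (p ^ e * m) <= gcd_mean h m.
  move=> hdec.
  apply: le_trans (le_gcd_mean (shift h hdec) M0 (dvdn_mull _ (dvdnn m))) _.
  rewrite /gcd_mean ler_pM2r ?invr_gt0 ?ltr0n //; apply: ler_sum => n _.
  by apply: hdec; rewrite ?muln_gt0 ?p0 ?gcdn_gt0 ?m0 ?orbT ?dvdn_mull.
rewrite Nm !gcd_mean_prime //.
have := IH _ MN _ _ M0 (shift f fdec) (shift g gdec).
have := IH _ mN _ _ m0 fdec gdec.
have := shift_le _ fdec; have := shift_le _ gdec.
have t0 : 0 < p%:R^-1 :> R by rewrite invr_gt0 ltr0n.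
have t1 : p%:R^-1 < 1 :> R by rewrite invf_lt1 ?ltr0n ?ltr1n.
move: (p%:R^-1) t0 t1 => t t0 t1.
set a0 := gcd_mean f m; set b0 := gcd_mean g m.
set a1 := gcd_mean (fun d => f (p * d)%N) _.
set b1 := gcd_mean (fun d => g (p * d)%N) _.
set c0 := gcd_mean (fun d => f d * g d) m.
set c1 := gcd_mean (fun d => f _ * g _) _.
move=> b10 a10 ab0 ab1.
have u0 : 0 <= 1 - t by rewrite subr_ge0 ltW.
have h0 : 0 <= (1 - t) * (c0 - a0 * b0) by rewrite mulr_ge0 // subr_ge0.
have h1 : 0 <= t * (c1 - a1 * b1) by rewrite mulr_ge0 ?(ltW t0) // subr_ge0.
have h2 : 0 <= t * (1 - t) * ((a0 - a1) * (b0 - b1)).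
  by apply: mulr_ge0; apply: mulr_ge0; rewrite ?subr_ge0 ?(ltW t0) ?(ltW t1).
(* The difference of the two sides is exactly the sum of the terms in [h0], [h1] and [h2]; the last
   one is the covariance of a two-point law, as in Chebyshev's sum inequality. *)
rewrite -subr_ge0; apply: le_trans (addr_ge0 (addr_ge0 h0 h1) h2) _.
by rewrite le_eqVlt; apply/orP; left; apply/eqP; ring.
Qed.

(** * The law of the gcd with a square *)

(** Writing [n = d * n'], the condition says that [n'] is coprime to [Q %/ d * Q]. Thanks to the
    square this means coprime to [Q], whatever [d] is, and [n'] runs over [Q %/ d] full periods
    modulo [Q]. *)
Lemma card_gcd_eq (Q d : nat) : (0 < Q)%N -> (d %| Q)%N ->
  \sum_(0 <= n < Q ^ 2) (gcdn n (Q ^ 2) == d : nat) = (Q %/ d * totient Q)%N.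
Proof.
move=> Q0 dQ; have d0 := dvdn_gt0 Q0 dQ.
have -> : (Q ^ 2)%N = (d * (Q %/ d * Q))%N by rewrite mulnA (mulnC d) divnK.
rewrite (eq_bigr (fun n =>
    if (d %| n)%N then (gcdn n (d * (Q %/ d * Q)) == d : nat) else 0)).
  rewrite -big_mkcond sum_nat_dvd //=.
  rewrite (eq_bigr (fun n => coprime Q n : nat)) => [|n _].
    rewrite sum_nat_periodic => [|n]; last by rewrite /coprime gcdnDr.
    by rewrite -mulr_natl natn totient_count_coprime big_mkord.
  rewrite -muln_gcdr -[X in _ == X]muln1 eqn_pmul2l // -/(coprime _ _).
  rewrite coprimeMr !(coprime_sym n) andbC; case cQ: (coprime Q n) => //=.
  by rewrite (coprime_dvdl _ cQ) // -[X in (_ %| X)%N](divnK dQ) dvdn_mulr.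
move=> n _; case: ifPn => // /negP dn; case: eqP => // e; case: dn.
by rewrite -e dvdn_gcdl.
Qed.

Lemma gcd_mean_truncated (R : numFieldType) (w : nat -> R) (Q x : nat) :
  (0 < Q)%N -> (forall d, (0 < d <= x)%N -> (d %| Q)%N) ->
  gcd_mean (fun d => w d * (d <= x)%:R) (Q ^ 2) =
  (totient Q)%:R / Q%:R * \sum_(1 <= d < x.+1) w d / d%:R.
Proof.
move=> Q0 dvdQ; have Q20 : (0 < Q ^ 2)%N by rewrite expn_gt0 Q0.
rewrite /gcd_mean; under eq_bigr => n _.
  have -> : w (gcdn n (Q ^ 2)) * (gcdn n (Q ^ 2) <= x)%:R =
      \sum_(1 <= d < x.+1) w d * (gcdn n (Q ^ 2) == d)%:R.
    have g0 : (0 < gcdn n (Q ^ 2))%N by rewrite gcdn_gt0 Q20 orbT.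
    case: leqP => gx.
      rewrite (bigD1_seq (gcdn n (Q ^ 2))) ?iota_uniq ?mem_index_iota ?g0 //=.
      by rewrite eqxx big1 ?addr0 // => d /negPf; rewrite eq_sym => ->; rewrite mulr0.
    rewrite mulr0 big_nat big1 // => d /andP[_ dx].
    by case: eqP => [e|_]; rewrite ?mulr0 //; move: gx; rewrite e ltnNge -ltnS dx.
  over.
rewrite exchange_big /= mulr_suml mulr_sumr !big_nat; apply: eq_bigr => d /andP[d0 dx].
have dQ : (d %| Q)%N by rewrite dvdQ // d0.
rewrite -mulr_sumr -natr_sum card_gcd_eq // natrM natf_div // natrX; field.
by rewrite !pnatr_eq0 -!lt0n Q0 d0.
Qed.

(* The correlation inequality for [f] and the indicator of [d <= x]: under the
   law of [gcd n (Q ^ 2)], an integer [d <= x] has weight proportional to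
   [1 / d], because [Q ^ 2 / d] has the same prime factors as [Q]. *)
Lemma gcd_mean_harmonic (R : realFieldType) (f : nat -> R) (Q x : nat) :
  dvd_decreasing f -> (0 < Q)%N -> (forall d, (0 < d <= x)%N -> (d %| Q)%N) ->
  gcd_mean f (Q ^ 2) * \sum_(1 <= d < x.+1) d%:R^-1 <=
  \sum_(1 <= d < x.+1) f d / d%:R.
Proof.
move=> fdec Q0 dvdQ; have Q20 : (0 < Q ^ 2)%N by rewrite expn_gt0 Q0.
(* The factor 1 gives the indicator the shape of [gcd_mean_truncated] with constant weight. *)
have gdec : @dvd_decreasing R (fun d => 1 * (d <= x)%:R).
  move=> d n n0 dn; rewrite !mul1r ler_nat.
  by case: (leqP n x) => // nx; rewrite (leq_trans (dvdn_leq n0 dn) nx).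
have := gcd_mean_correlation Q20 fdec gdec.
have -> : (fun d => f d * (1 * (d <= x)%:R)) = (fun d => f d * (d <= x)%:R).
  by apply/funext => d; rewrite mul1r.
rewrite !gcd_mean_truncated //.
under eq_bigr do rewrite mul1r.
by rewrite mulrCA ler_pM2l // divr_gt0 // ltr0n ?totient_gt0.
Qed.

(** * Natural and logarithmic density *)

Lemma harmonic_unbounded (R : realType) (c : R) :
  exists n, c <= \sum_(1 <= d < n.+1) d%:R^-1.
Proof.
(* Each dyadic block from [2 ^ m + 1] to [2 ^ m.+1] contributes at least 1/2. *)
have H m : (m%:R / 2 : R) <= \sum_(1 <= d < (2 ^ m).+1) d%:R^-1.
  elim: m => [|m IH]; first by rewrite mul0r sumr_ge0.
  have le1 : (2 ^ m <= 2 ^ m.+1)%N by rewrite leq_exp2l.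
  rewrite (big_cat_nat (n := (2 ^ m).+1)) //= -natr1 mulrDl lerD //.
  have -> : 1 / 2 = \sum_((2 ^ m).+1 <= d < (2 ^ m.+1).+1) (2 ^ m.+1)%:R^-1 :> R.
    rewrite sumr_const_nat subSS expnS mul2n -addnn addnK -mulr_natl addnn -mul2n natrM.
    by field; rewrite pnatr_eq0 expn_eq0.
  rewrite !big_nat; apply: ler_sum => d /andP[d0 d1].
  by rewrite lef_pV2 ?posrE ?ltr0n ?ler_nat ?expn_gt0 //; apply: leq_trans d0.
exists (2 ^ (Num.truncn (2 * c)).+1)%N; apply: le_trans (H _).
by rewrite ler_pdivlMr // mulrC ltW // truncnS_gt.
Qed.

(** The term at 0 vanishes; starting there fits the ranges of [sum_nat_dvd]. *)
Definition missing (R : pzRingType) (A : set nat) (n : nat) : R :=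
  \sum_(0 <= k < n.+1) (k \in Npos `\` A)%:R.

(** Density one freed of limits, quotients and real cutoffs; [has_density1P] justifies it for sets
    of positive integers. *)
Definition negligible_complement (R : numDomainType) (A : set nat) : Prop :=
  forall e : R, 0 < e ->
  exists n0, forall n, (n0 <= n)%N -> missing R A n <= e * n%:R.

Lemma missing_ge0 (R : numDomainType) (A : set nat) (n : nat) :
  0 <= missing R A n.
Proof. by apply: sumr_ge0 => k _; rewrite ler0n. Qed.

Lemma in_NposD (A : set nat) (k : nat) :
  (k \in Npos `\` A) = (0 < k)%N && (k \notin A).
Proof.
by rewrite in_setD; congr (_ && _); apply/idP/idP => [/set_mem|/mem_set].
Qed.

Lemma counting_function_missing (R : realType) (A : set nat) (x : R) :
  A `<=` Npos -> 0 <= x ->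
  (counting_function A x)%:R + missing R A (Num.truncn x) = (Num.truncn x)%:R.
Proof.
move=> Apos x0; set n := Num.truncn x.
have -> : counting_function A x = size [seq k <- index_iota 1 n.+1 | k \in A].
  apply/perm_size/uniq_perm.
  - exact: fset_uniq.
  - by rewrite filter_uniq ?iota_uniq.
  move=> k; rewrite in_fset_set; last exact: finite_upto.
  rewrite mem_filter mem_index_iota ltnS /n truncn_ge_nat //.
  apply/idP/idP => [/set_mem[/mem_set -> /=]|/andP[/set_mem kA kx]].
    by rewrite ler1n.
  by apply/mem_set; split => //=; rewrite ler1n.
rewrite size_filter -sum1_count natr_sum big_mkcond /missing [in X in _ + X]big_ltn //=.
rewrite in_NposD add0r -big_split /=.
rewrite (eq_big_nat _ _ (F2 := fun=> 1)) => [|k /andP[k0 _]].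
  by rewrite sumr_const_nat subSS subn0.
by rewrite in_NposD k0; case: (k \in A); rewrite ?addr0 ?add0r.
Qed.

Lemma has_density1P (R : realType) (A : set nat) : A `<=` Npos ->
  has_density A (1 : R) <-> negligible_complement R A.
Proof.
move=> Apos; split => [/cvgrPdist_le dA e e0|nA].
  have [M [_ HM]] := dA e e0.
  (* The maximum makes the truncated number nonnegative, so that [n] exceeds [M]; the successor also
     makes [n] positive. *)
  exists (Num.truncn (Num.max M 0)).+1 => n hn.
  have n0 : 0 < n%:R :> R by rewrite ltr0n (leq_trans _ hn).
  have Mn : M < n%:R.
    apply: le_lt_trans (_ : Num.max M 0 < _); first by rewrite le_max lexx.
    by rewrite -truncn_lt_nat // le_max lexx orbT.
  have := counting_function_missing Apos (ltW n0); rewrite natrK addrC.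
  move/eqP; rewrite eq_sym -subr_eq => /eqP <-.
  have /ler_normlP[_] := HM _ Mn.
  rewrite -{1}(divff (lt0r_neq0 n0)) -mulrBl ler_pdivrMr //.
apply/cvgrPdist_le => e e0.
have e20 : 0 < e / 2 by rewrite divr_gt0.
have [n0 Hn0] := nA _ e20.
near=> x.
have x0 : 0 < x by near: x; exact: nbhs_pinfty_gt.
have nx : (n0 <= Num.truncn x)%N.
  by rewrite truncn_ge_nat ?(ltW x0) //; near: x; exact: nbhs_pinfty_ge.
(* From here on the loss of less than 1 between [x] and its integer part is at most [e / 2 * x]. *)
have ex : 2 / e <= x by near: x; apply: nbhs_pinfty_ge; exact: num_real.
have := counting_function_missing Apos (ltW x0).
have := Hn0 _ nx; have := missing_ge0 R A (Num.truncn x).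
have := truncn_itv (ltW x0); rewrite -natr1.
move: (missing _ _ _) ((Num.truncn x)%:R) (counting_function A x)%:R.
move=> m t c /andP[tx xt] m0 mt cm.
have -> : 1 - c / x = (x - c) / x by rewrite mulrBl divff // gt_eqF.
rewrite ger0_norm; last by apply: divr_ge0; [lra|exact: ltW].
rewrite ler_pdivrMr //.
have : 2 <= e * x by move: ex; rewrite ler_pdivrMr // mulrC.
have : e / 2 * t <= e / 2 * x by rewrite ler_pM2l.
have : e / 2 * x = e * x / 2 by rewrite mulrAC.
by lra.
Unshelve. all: by end_near.
Qed.

(** Natural density zero forces small logarithmic averages: partial summation bounds the weighted
    sum by [e / 2] times the harmonic sum plus a bounded term, which the divergent harmonic sum
    absorbs. *)
Lemma log_density0 (R : realType) (A : set nat) (e : R) :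
  negligible_complement R A -> 0 < e ->
  exists n, 0 < \sum_(1 <= d < n.+1) (d%:R^-1 : R) /\
  \sum_(1 <= d < n.+1) (d \in Npos `\` A)%:R / d%:R
    <= e * \sum_(1 <= d < n.+1) d%:R^-1.
Proof.
move=> nA e0; have e20 : 0 < e / 2 by rewrite divr_gt0.
have [n0 Hn0] := nA _ e20.
pose H n : R := \sum_(1 <= d < n.+1) d%:R^-1.
pose u n : R := \sum_(1 <= d < n.+1) (d \in Npos `\` A)%:R / d%:R.
have H0 n : 0 <= H n by apply: sumr_ge0 => d _; rewrite invr_ge0.
have HS n : H n.+1 = H n + n.+1%:R^-1 by rewrite /H big_nat_recr.
have Hle m n : (m <= n)%N -> H m <= H n.
  move/subnKC => <-; elim: (n - m)%N => [|k IH]; rewrite ?addn0 // addnS HS.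
  by rewrite ler_wpDr ?invr_ge0.
(* Summation by parts, written as an induction. *)
have key k : u (n0 + k)%N <=
    u n0 + e / 2 * H (n0 + k)%N + missing R A (n0 + k) / (n0 + k)%:R.
  elim: k => [|k IH].
    rewrite addn0 -addrA ler_wpDr // addr_ge0 ?mulr_ge0 ?divr_ge0 //.
      exact: ltW.
    exact: missing_ge0.
  rewrite addnS; move: (n0 + k)%N (leq_addr k n0) IH => n hn IH.
  have uS : u n.+1 = u n + (n.+1 \in Npos `\` A)%:R / n.+1%:R.
    by rewrite /u big_nat_recr.
  rewrite HS uS /missing big_nat_recr //= -/(missing R A n) mulrDl addrA lerD2r.
  apply: le_trans IH _; rewrite mulrDr !addrA -[leRHS]addrA lerD2l.
  have n10 : 0 < n.+1%:R :> R by rewrite ltr0n.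
  (* At [n = 0] the quotient is 0, since the inverse of 0 is 0. *)
  have [->|n_gt0] := posnP n.
    by rewrite invr0 mulr0 addr_ge0 ?mulr_ge0 ?missing_ge0 ?invr_ge0 // ltW.
  have nR : 0 < n%:R :> R by rewrite ltr0n.
  rewrite -mulrDl ler_pdivrMr // [leRHS]mulrAC ler_pdivlMr // -natr1.
  by have := Hn0 n hn; move: (missing _ _ _) (n%:R : R) => m t; lra.
(* The bound 1 makes the harmonic sum positive; the other one lets half of [e] times it absorb
   [u n0] and the boundary term, at most [e / 2]. *)
have [n1 Hn1] := harmonic_unbounded (Num.max 1 (2 / e * (u n0 + e / 2))).
have Hn1' : Num.max 1 (2 / e * (u n0 + e / 2)) <= H (n0 + n1)%N.
  by apply: le_trans Hn1 _; apply: Hle; rewrite leq_addl.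
move: Hn1'; rewrite ge_max => /andP[h1 h2].
exists (n0 + n1)%N; split; first exact: lt_le_trans ltr01 h1.
apply: le_trans (key n1) _; rewrite -/(H _).
have : missing R A (n0 + n1) / (n0 + n1)%:R <= e / 2.
  have [->|n_gt0] := posnP (n0 + n1)%N; first by rewrite invr0 mulr0 ltW.
  by rewrite ler_pdivrMr ?ltr0n // Hn0 ?leq_addr.
have : u n0 + e / 2 <= e / 2 * H (n0 + n1)%N.
  by move: h2; rewrite -ler_pdivlMl ?invf_div ?divr_gt0.
move: (u _) (missing _ _ _ / _) (H _) => a b c; lra.
Qed.

(** * The sieve by [B] and the product set *)

Definition sieve (B : set nat) (x k : nat) : bool :=
  all (fun b => (b \in B) ==> ~~ (b %| k)%N) (index_iota 1 x.+1).

(** With [N] the square of [x!], every [b] up to [x] divides [N], so the sieve sees only the gcd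
    with [N]. Its indicator decreases along divisibility, and [gcd_mean_harmonic] reduces the mean
    to a logarithmic average, small by the choice of [x]. *)
Lemma sieve_mean (R : realType) (B : set nat) (e : R) :
  negligible_complement R B -> 0 < e ->
  exists x N, [/\ (0 < N)%N,
    forall k, sieve B x (gcdn k N) = sieve B x k &
    gcd_mean (fun k => (sieve B x k)%:R) N <= e].
Proof.
move=> nB e0; have [x [H0 Hx]] := log_density0 nB e0.
have Q0 := fact_gt0 x.
have dvdQ d : (0 < d <= x)%N -> (d %| x`!)%N by move=> /dvdn_fact.
have fdec : dvd_decreasing (fun k => (sieve B x k)%:R : R).
  move=> d n _ dn; rewrite ler_nat.
  have [/allP nS|//] := boolP (sieve B x n).
  rewrite (_ : sieve B x d) //; apply/allP => b /nS /implyP bn; apply/implyP => /bn.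
  by apply: contraNN => /dvdn_trans; exact.
exists x, (x`! ^ 2)%N; split; first by rewrite expn_gt0 Q0.
  move=> k; apply: eq_in_all => b; rewrite mem_index_iota ltnS => /dvdQ bQ.
  by rewrite dvdn_gcd (dvdn_mulr _ bQ : (b %| x`! ^ 2)%N) andbT.
rewrite -(ler_pM2r H0); apply: le_trans (gcd_mean_harmonic fdec Q0 dvdQ) _.
apply: le_trans Hx; rewrite !big_nat; apply: ler_sum => d /andP[d0 dx].
rewrite ler_pM2r ?invr_gt0 ?ltr0n // ler_nat in_NposD d0 /=.
(* An element [d] of [B] up to [x] is among the tested divisors of itself, so it is sieved out. *)
case dB: (d \in B) => //=; rewrite ?leq_b1 // leqn0 eqb0.
by apply/allPn; exists d; rewrite ?mem_index_iota ?d0 // dB dvdnn.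
Qed.

(** If a positive [k] outside the product set has a divisor [b] in [B] with [b <= x], then [k %/ b]
    is not in [A]. For each [b] these quotients are distinct and at most [n], whence the factor
    [x]. *)
Lemma missing_product (R : realDomainType) (A B : set nat) (x n : nat) :
  missing R (product_set A B) n <=
  \sum_(0 <= k < n.+1) (sieve B x k)%:R + x%:R * missing R A n.
Proof.
have -> : x%:R * missing R A n = \sum_(1 <= b < x.+1) missing R A n.
  by rewrite sumr_const_nat subSS subn0 mulr_natl.
have term k : (k \in Npos `\` product_set A B)%:R <= (sieve B x k)%:R +
    \sum_(1 <= b < x.+1) (if (b %| k)%N then ((k %/ b)%N \in Npos `\` A)%:R else 0) :> R.
  rewrite in_NposD.
  have sum0 : 0 <= \sum_(1 <= b < x.+1)
      (if (b %| k)%N then ((k %/ b)%N \in Npos `\` A)%:R else 0) :> R.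
    by apply: sumr_ge0 => b _; case: ifP.
  have [/andP[k0 kAB]|_] := boolP (_ && _); last by rewrite addr_ge0.
  have [_|] := boolP (sieve B x k); first by rewrite lerDl.
  case/allPn => b; rewrite mem_index_iota => bx.
  rewrite negb_imply negbK => /andP[bB bk].
  rewrite add0r (bigD1_seq b) ?iota_uniq ?mem_index_iota //= bk in_NposD.
  have b0 : (0 < b)%N by case/andP: bx.
  have -> : (k %/ b)%N \notin A.
    apply: contraNN kAB => /set_mem kA; apply/mem_set.
    by exists (k %/ b)%N => //; exists b; [exact/set_mem|rewrite divnK].
  rewrite divn_gt0 // dvdn_leq //=.
  by rewrite lerDl; apply: sumr_ge0 => c _; case: ifP.
apply: le_trans (ler_sum _ (fun k _ => term k)) _.
rewrite big_split /= lerD2l exchange_big /= !big_nat.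
apply: ler_sum => b /andP[b0 _].
rewrite -big_mkcond /missing.
have -> : \sum_(0 <= k < n.+1) (k \in Npos `\` A)%:R =
    \sum_(0 <= k < b * n.+1 | (b %| k)%N) ((k %/ b)%N \in Npos `\` A)%:R :> R.
  by rewrite sum_nat_dvd //; apply: eq_bigr => k _; rewrite mulKn.
(* Extending the range of [k] to [b * n.+1] only adds nonnegative terms and makes the quotients run
   over all of [0..n]. *)
rewrite [leRHS](big_cat_nat (n := n.+1)) ?leq_pmull //= lerDl.
exact: sumr_ge0.
Qed.

Lemma negligible_complement_product (R : realType) (A B : set nat) :
  negligible_complement R A -> negligible_complement R B ->
  negligible_complement R (product_set A B).
Proof.
move=> nA nB e e0; have e30 : 0 < e / 3 by rewrite divr_gt0.
have [x [N [N0 sieveN meanN]]] := sieve_mean nB e30.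
(* The successor keeps the denominator positive for every [x]. *)
have ex0 : 0 < e / 3 / x.+1%:R by rewrite divr_gt0.
have [n0 Hn0] := nA _ ex0.
exists (maxn n0 N.+1) => n; rewrite geq_max => /andP[n0n Nn].
apply: le_trans (missing_product R A B x n) _.
have hA : x%:R * missing R A n <= e / 3 * n%:R.
  apply: le_trans (_ : x.+1%:R * missing R A n <= _).
    by rewrite ler_wpM2r ?missing_ge0 // ler_nat.
  by have := Hn0 n n0n; rewrite mulrAC ler_pdivlMr ?ltr0n // mulrC.
(* The range is covered by [q] full periods; their total length is at most [n + 1 + N], hence at
   most [2 * n] as [n] exceeds [N]. This costs two of the three thirds of [e]. *)
have hS : \sum_(0 <= k < n.+1) (sieve B x k)%:R <= e / 3 * (2 * n%:R) :> R.
  set q := (n.+1 %/ N).+1.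
  have nq : (n.+1 <= q * N)%N by rewrite ltnW // ltn_ceil.
  apply: (@le_trans _ _ (\sum_(0 <= k < q * N) (sieve B x k)%:R)).
    by rewrite [leRHS](big_cat_nat (n := n.+1)) //= lerDl sumr_ge0.
  under eq_bigr do rewrite -sieveN.
  rewrite (sum_gcd_dvd (fun k => (sieve B x k)%:R)) ?muln_gt0 ?N0 ?dvdn_mull //.
  apply: ler_pM => //.
    by rewrite divr_ge0 // sumr_ge0.
  rewrite -natrM ler_nat /q mulSn.
  have := leq_trunc_div n.+1 N; lia.
by move: hA hS; lra.
Qed.

Theorem theorem1p1 (R : realType) (A B : set nat)
    (A_pos : A `<=` Npos) (B_pos : B `<=` Npos)
    (dA : has_density A (1 : R)) (dB : has_density B (1 : R)) :
  has_density (product_set A B) (1 : R).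
Proof.
apply/has_density1P.
  by move=> _ [a /A_pos a0 [b /B_pos b0 <-]]; rewrite /Npos /= muln_gt0 a0.
by apply: negligible_complement_product; apply/has_density1P.
Qed.
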